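(* Let $\Sigma$ be a non-lacunary semigroup of $\mathbb{N}$, let $K\subset\mathbb{N}$ be a set that contains multiples of every positive integer (that is, for every $n\in\mathbb{N}$ there is an element of $K$ divisible by $n$), and let $P$ be a non-constant polynomial with integer coefficients satisfying $P(0)=0$. Then the set $\{P(ks)\colon k\in K,\ s\in\Sigma\}$ is a set of Bohr recurrence.
   Context: $\mathbb{N}$ denotes the set of positive integers and $\mathbb{T}=\mathbb{R}/\mathbb{Z}$. For $x\in\mathbb{R}$, $\|x\|_{\mathbb{T}}$ denotes the distance from $x$ to the nearest integer. A semigroup of $\mathbb{N}$ is a sub-semigroup of $(\mathbb{N},\cdot)$. Two integers $p,q\ge 2$ are multiplicatively independent if their only common power is $1$, i.e. there are no $a,b\in\mathbb{N}$ with $p^a=q^b$. A semigroup of $\mathbb{N}$ is non-lacunary if it contains two multiplicatively independent integers (equivalently, it is not contained in the set of powers of a single integer). A subset $R$ of the integers is a set of Bohr recurrence if for every $d\in\mathbb{N}$, all $\alpha_1,\dots,\alpha_d\in\mathbb{R}$, and every $\varepsilon>0$, there exists a non-zero $r\in R$ such that $\|r\alpha_j\|_{\mathbb{T}}\le\varepsilon$ for $j=1,\dots,d$. *)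

(* Defs.v *)
From mathcomp Require Import all_boot all_order all_algebra.
From mathcomp Require Import all_classical all_reals.

Set Implicit Arguments.
Unset Strict Implicit.
Unset Printing Implicit Defensive.

Import Order.TTheory GRing.Theory Num.Theory.

Local Open Scope classical_set_scope.
Local Open Scope ring_scope.

(* [nat] contains 0, so membership in the positive integers is imposed
   explicitly as a subset condition where it is needed. *)
Definition posnats : set nat := [set n | (0 < n)%N].

Definition torus_norm (R : realType) (x : R) : R :=
  inf [set `|x - m%:~R| | m in [set: int]].

Definition is_semigroup (S : set nat) : Prop :=
  S `<=` posnats /\ forall a b : nat, S a -> S b -> S (a * b)%N.

Definition mult_independent (p q : nat) : Prop :=
  ~ exists a b : nat, [/\ (0 < a)%N, (0 < b)%N & (p ^ a = q ^ b)%N].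

Definition non_lacunary (S : set nat) : Prop :=
  exists p q : nat,
    [/\ S p, S q, (2 <= p)%N, (2 <= q)%N & mult_independent p q].

Definition bohr_recurrence (R : realType) (A : set int) : Prop :=
  forall (d : nat) (alpha : 'I_d -> R) (eps : R), (0 < d)%N -> 0 < eps ->
    exists r : int, [/\ A r, r != 0 &
      forall j : 'I_d, torus_norm (r%:~R * alpha j) <= eps].

(* Main.v *)
Require Import Defs.
From mathcomp Require Import all_boot all_order all_algebra.
From mathcomp Require Import all_classical all_reals.
From mathcomp Require Import cyclic topology normedtype.
From mathcomp Require Import ring lra.

Import Order.TTheory GRing.Theory Num.Theory numFieldNormedType.Exports.

Local Open Scope classical_set_scope.
Local Open Scope ring_scope.

(** Write [P(ks) alpha_j] as the sum over [i >= 1] of [k^i s^i x_ij], where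
    [x_ij = P_i alpha_j].  Each integer [s] acts on the torus of points
    [(x_ij)], multiplying the coordinate [(i, j)] by [s ^ i].  If the closure
    of the orbit of [(x_ij)] under the semigroup contains a point all of whose
    coordinates are rational, with common denominator [n], then for every [k]
    divisible by [n] multiplication by [k ^ i] sends this point to [0]; by
    continuity some [s] makes every [k^i s^i x_ij] close to an integer.  The
    divisibility property of [K] provides such a [k], as large as desired, so
    that [ks] also avoids the roots of [P].

    Orbit closures on tori of dimension at least 2 can be complicated, but a
    rational point in them can be found one coordinate at a time
    ([simultaneous_near_int]): once some [s_m] bring the first coordinates
    close to rationals, extract a limit [y] of the last coordinate along [s_m]
    and apply the one-dimensional result to [y].  The elements of the
    semigroup used for [y] are chosen before [m], so they disturb the
    coordinates already treated as little as desired.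

    The one-dimensional result ([invariant_set_rational]) is the heart of
    Furstenberg's theorem on multiplication by [p] and [q] on the circle:
    a nonempty closed set [A] invariant under both contains a rational.  The
    proof is Boshernitzan's.  If [A] has no rationals, it contains distinct
    points that are arbitrarily close; as the ratios of consecutive products
    [p ^ a * q ^ b] tend to [1] ([products_have_small_gaps]), the multiples of
    a small difference by these products come close to any [r > 0], so [r]
    is a difference of two points of [A] ([invariant_set_differences]).  With
    [r = 1/t], [t] coprime to [p q], and [p], [q] replaced by powers that are
    [1] modulo [t], translation by [1/t] commutes with the action on the
    circle, so this can be iterated inside the intersection of [A] with its
    translate: [A] contains an arithmetic progression of step [1/t] around the
    circle ([invariant_set_progression]).  Hence [A] is dense, and being closed
    it contains [0], a contradiction. *)

(** * Gaps between products of powers of two integers *)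

Lemma bounded_injection_has_close_values {R : realType} {f : nat -> R} {M eps : R} :
  injective f -> (forall i, 0 <= f i <= M) -> 0 < eps ->
  exists i j, 0 < f i - f j < eps.
Proof.
move=> f_inj f_bnd eps0.
pose N := Num.truncn (M / eps).
have f_ge0 i : 0 <= f i / eps by apply: divr_ge0 (ltW eps0); case/andP: (f_bnd i).
have gN i : (Num.truncn (f i / eps) < N.+1)%N.
  rewrite truncn_lt_nat //; apply: le_lt_trans (truncnS_gt (M / eps)).
  by rewrite ler_pM2r ?invr_gt0 //; case/andP: (f_bnd i).
pose h (i : 'I_N.+2) : 'I_N.+1 := Ordinal (gN i).
have /injectivePn[i [j ij hij]] : ~~ injectiveb h.
  by apply/injectiveP => /leq_card; rewrite !card_ord ltnn.
have {hij} gij : Num.truncn (f i / eps) = Num.truncn (f j / eps).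
  by have := congr1 val hij.
have close x y : Num.truncn (f x / eps) = Num.truncn (f y / eps) ->
    f x - f y < eps.
  move=> gxy; have /andP[_ lt] := truncn_itv (f_ge0 x).
  have /andP[le _] := truncn_itv (f_ge0 y).
  rewrite -[ltRHS]mul1r -ltr_pdivrMr // mulrBl.
  move: lt le; rewrite gxy -natr1; lra.
have fij : f i != f j by apply: contraNneq ij => /f_inj ?; apply/eqP/val_inj.
case: (ltgtP (f i) (f j)) fij => // lt _.
- by exists j, i; rewrite subr_gt0 lt close.
- by exists i, j; rewrite subr_gt0 lt close.
Qed.

(** Normalising [p ^ i] by the largest power of [q] below it gives infinitely
    many values between [1] and [q], distinct by multiplicative independence; two of
    them are close, and their quotient is a ratio of a power of [p] and a power
    of [q].  Which of the two powers is the larger is not controlled. *)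
Lemma close_powers {R : realType} {p q : nat} {eta : R} :
  (1 < p)%N -> (1 < q)%N -> mult_independent p q -> 0 < eta ->
  exists a b : nat,
    q%:R ^+ b < p%:R ^+ a :> R /\ p%:R ^+ a < (1 + eta) * q%:R ^+ b \/
    p%:R ^+ a < q%:R ^+ b :> R /\ q%:R ^+ b < (1 + eta) * p%:R ^+ a.
Proof.
move=> p1 q1 indep eta0.
have p0 : (0 < p)%N := ltnW p1.
have q0 : (0 < q)%N := ltnW q1.
pose b i := trunc_log q (p ^ i).
have pX0 i : (0 < p ^ i)%N by rewrite expn_gt0 p0.
have qX0 i : (0 < q ^ i)%N by rewrite expn_gt0 q0.
have b_bnd i : (q ^ b i <= p ^ i < q ^ (b i).+1)%N by apply: trunc_log_bounds.
have b_mono i j : (i <= j)%N -> (b i <= b j)%N.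
  by move=> ij; apply: leq_trunc_log; rewrite leq_exp2l.
pose y i : R := p%:R ^+ i / q%:R ^+ b i.
have P0 i : 0 < p%:R ^+ i :> R by rewrite exprn_gt0 // ltr0n.
have Q0 i : 0 < q%:R ^+ i :> R by rewrite exprn_gt0 // ltr0n.
have y_bnd i : 1 <= y i <= q%:R.
  have /andP[l u] := b_bnd i.
  rewrite /y ler_pdivlMr // mul1r ler_pdivrMr // -exprS -!natrX !ler_nat l.
  exact: ltnW.
have lt_neq i j : (i < j)%N -> y i <> y j.
  move=> ij /eqP; rewrite /y eqr_div ?lt0r_neq0 // -!natrX -!natrM eqr_nat.
  have bij := b_mono _ _ (ltnW ij).
  rewrite -[b j](subnKC bij) -[in (p ^ j)%N](subnKC (ltnW ij)).
  rewrite !expnD => /eqP E.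
  have {}E : (p ^ (j - i) = q ^ (b j - b i))%N.
    apply/eqP; rewrite -(eqn_pmul2l (pX0 i)) -(eqn_pmul2r (qX0 (b i))).
    by apply/eqP; rewrite -E; ring.
  apply: indep; exists (j - i)%N, (b j - b i)%N; split=> //; first by rewrite subn_gt0.
  rewrite lt0n; apply/eqP => b0; move: E; rewrite b0 expn0 => /eqP.
  by rewrite -(expn0 p) eqn_exp2l // subn_eq0 leqNgt ij.
have y_inj : injective y.
  by move=> i j yij; case: (ltngtP i j) => // /lt_neq; rewrite yij.
have y_bnd0 i : 0 <= y i <= q%:R.
  by have /andP[l ->] := y_bnd i; rewrite (le_trans ler01 l).
have [i [j /andP[lt0 lte]]] := bounded_injection_has_close_values y_inj y_bnd0 eta0.
have /andP[yj1 _] := y_bnd j.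
have lt1 : y j < y i by lra.
have lt2 : y i < (1 + eta) * y j by nra.
have {}lt1 : p%:R ^+ j * q%:R ^+ b i < p%:R ^+ i * q%:R ^+ b j :> R.
  by move: lt1; rewrite /y ltr_pdivlMr // mulrAC ltr_pdivrMr.
have {}lt2 : p%:R ^+ i * q%:R ^+ b j < (1 + eta) * (p%:R ^+ j * q%:R ^+ b i).
  rewrite -ltr_pdivlMr // (_ : _ / _ = (1 + eta) * y j * q%:R ^+ b i).
    by rewrite -ltr_pdivrMr.
  by rewrite /y; ring.
case: (ltngtP i j) => [ij|ij|ij]; last by move: lt0; rewrite ij subrr ltxx.
- have bij := b_mono _ _ (ltnW ij).
  move: lt1 lt2; rewrite -[b j](subnKC bij) -[in p%:R ^+ j](subnKC (ltnW ij)) !exprD.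
  have : 0 < p%:R ^+ i * q%:R ^+ b i :> R by apply: mulr_gt0.
  set A := _ * _ => A0 lt1 lt2.
  exists (j - i)%N, (b j - b i)%N; right. split.
    by rewrite -(ltr_pM2l A0) /A; move: lt1; congr (_ < _); ring.
  by rewrite -(ltr_pM2l A0) /A; move: lt2; congr (_ < _); ring.
- have bij := b_mono _ _ (ltnW ij).
  move: lt1 lt2; rewrite -[b i](subnKC bij) -[in p%:R ^+ i](subnKC (ltnW ij)) !exprD.
  have : 0 < p%:R ^+ j * q%:R ^+ b j :> R by apply: mulr_gt0.
  set A := _ * _ => A0 lt1 lt2.
  exists (i - j)%N, (b i - b j)%N; left. split.
    by rewrite -(ltr_pM2l A0) /A; move: lt1; congr (_ < _); ring.
  by rewrite -(ltr_pM2l A0) /A; move: lt2; congr (_ < _); ring.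
Qed.

(** Bernoulli's inequality. *)
Lemma powers_unbounded {R : realType} (u M : R) :
  1 < u -> exists k : nat, M < u ^+ k.
Proof.
move=> u1; have v0 : 0 < u - 1 by rewrite subr_gt0.
have bern k : 1 + (u - 1) * k%:R <= u ^+ k.
  elim: k => [|k IHk]; first by rewrite mulr0 addr0 expr0.
  have k0 : 0 <= k%:R :> R by [].
  rewrite exprS -natr1; have u0 : 0 <= u by lra.
  apply: le_trans (ler_wpM2l u0 IHk).
  have := mulr_ge0 (mulr_ge0 (ltW v0) (ltW v0)) k0; nra.
exists (Num.truncn (M / (u - 1))).+1.
apply: lt_le_trans (bern _); have := truncnS_gt (M / (u - 1)).
by rewrite ltr_pdivrMr //; nra.
Qed.

(** Let [u = p ^ a / q ^ b].  Between [q ^ j] and [q ^ j.+1] the points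
    [q ^ j * u ^ i] grow by a factor less than [1 + eta], and boundedly many of
    them are needed; when [j] is large enough each of them is an integer
    [p ^ (a * i) * q ^ (j - b * i)]. *)
Lemma products_have_small_gaps_of_ratio {R : realType} {p q a b : nat} {eta : R} :
  (1 < p)%N -> (1 < q)%N -> 0 < eta ->
  q%:R ^+ b < p%:R ^+ a :> R -> p%:R ^+ a < (1 + eta) * q%:R ^+ b ->
  exists N : R, forall z, N <= z -> exists c d : nat,
    (p ^ c * q ^ d)%:R <= z /\ z < (1 + eta) * (p ^ c * q ^ d)%:R.
Proof.
move=> p1 q1 eta0 ltr ltr_eta.
have p0 : (0 < p)%N := ltnW p1; have q0 : (0 < q)%N := ltnW q1.
have P0 i : 0 < p%:R ^+ i :> R by rewrite exprn_gt0 // ltr0n.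
have Q0 i : 0 < q%:R ^+ i :> R by rewrite exprn_gt0 // ltr0n.
pose u : R := p%:R ^+ a / q%:R ^+ b.
have u1 : 1 < u by rewrite /u ltr_pdivlMr // mul1r.
have u_eta : u < 1 + eta by rewrite /u ltr_pdivrMr.
have [k qk] := powers_unbounded _ q%:R u1.
exists (q%:R ^+ (b * k)) => z Nz.
have z1 : 1 <= z by apply: le_trans Nz; rewrite exprn_ege1 // ler1n.
pose j := trunc_log q (Num.truncn z).
have tz0 : (0 < Num.truncn z)%N by rewrite truncn_gt0.
have /andP[jl ju] := trunc_log_bounds q1 tz0.
have {}jl : q%:R ^+ j <= z.
  rewrite -natrX; apply: le_trans (_ : (Num.truncn z)%:R <= z).
    by rewrite ler_nat.
  by rewrite truncn_le; lra.
have {}ju : z < q%:R ^+ j.+1.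
  apply: lt_le_trans (truncnS_gt z) _; rewrite -natrX ler_nat; exact: ju.
have bkj : (b * k <= j)%N.
  by rewrite -ltnS -(ltr_eXn2l (x := q%:R : R)) ?ltr1n //; apply: le_lt_trans ju.
have exi : exists i, z < q%:R ^+ j * u ^+ i.
  exists k; apply: lt_trans ju _.
  by rewrite exprS mulrC ltr_pM2l.
case: (ex_minnP exi) => [[|i] lti min_i].
  by move: lti; rewrite expr0 mulr1 ltNge jl.
have lei : q%:R ^+ j * u ^+ i <= z.
  by rewrite leNgt; apply/negP => /min_i; rewrite ltnn.
have ik : (i < k)%N.
  apply: min_i; apply: lt_trans ju _.
  by rewrite exprS mulrC ltr_pM2l.
have bij : (b * i <= j)%N by apply: leq_trans bkj; rewrite leq_mul2l (ltnW ik) orbT.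
have sE : (p ^ (a * i) * q ^ (j - b * i))%:R = q%:R ^+ j * u ^+ i.
  rewrite natrM !natrX /u expr_div_n -!exprM -[in RHS](subnKC bij) exprD.
  by field; rewrite lt0r_neq0.
exists (a * i)%N, (j - b * i)%N; rewrite sE; split=> //.
apply: lt_trans lti _; rewrite exprS mulrCA ltr_pM2r //.
by rewrite mulr_gt0 // exprn_gt0 //; lra.
Qed.

(** Furstenberg's lemma: in a non-lacunary semigroup the ratio of consecutive
    elements tends to [1]. *)
Lemma products_have_small_gaps {R : realType} {p q : nat} (eta : R) :
  (1 < p)%N -> (1 < q)%N -> mult_independent p q -> 0 < eta ->
  exists N : R, forall z, N <= z -> exists c d : nat,
    (p ^ c * q ^ d)%:R <= z /\ z < (1 + eta) * (p ^ c * q ^ d)%:R.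
Proof.
move=> p1 q1 indep eta0.
have [a [b [[lt1 lt2]|[lt1 lt2]]]] := close_powers p1 q1 indep eta0.
  exact: products_have_small_gaps_of_ratio p1 q1 eta0 lt1 lt2.
have [N gapN] := products_have_small_gaps_of_ratio q1 p1 eta0 lt1 lt2.
by exists N => z /gapN[c [d]]; rewrite mulnC; exists d, c.
Qed.

(** * Closed subsets of the circle invariant under two multiplications *)

(** A closed subset of [R / Z] stable under multiplication by [p] and by [q],
    represented by its preimage in [R]: hence the stability under integer
    translations. *)
Record invariant_set {R : realType} (p q : nat) (A : set R) : Prop := InvariantSet {
  invariant_closed : closed A;
  invariant_shift : forall x (m : int), A x -> A (x + m%:~R);
  invariant_mull : forall x, A x -> A (p%:R * x);
  invariant_mulr : forall x, A x -> A (q%:R * x) }.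

Arguments invariant_closed {R p q A} _.
Arguments invariant_shift {R p q A} _ x m _.
Arguments invariant_mull {R p q A} _ x _.
Arguments invariant_mulr {R p q A} _ x _.

Definition without_rationals {R : realType} (A : set R) : Prop :=
  forall x (n : nat) (m : int), A x -> (0 < n)%N -> n%:R * x <> m%:~R.

Lemma closed_approx {R : realType} {A : set R} {x : R} :
  closed A -> (forall eps, 0 < eps -> exists2 y, A y & `|x - y| < eps) -> A x.
Proof.
move=> clA apx; apply: clA => B /nbhs_ballP[e /= e0 eB].
by have [y Ay xy] := apx e e0; exists y; split=> //; apply: eB.
Qed.

Lemma invariant_mulX {R : realType} {p q : nat} {A : set R} {x : R} (c d : nat) :
  invariant_set p q A -> A x -> A ((p ^ c * q ^ d)%:R * x).
Proof.
move=> invA Ax; elim: c => [|c IHc].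
  elim: d => [|d IHd]; first by rewrite mul1r.
  by rewrite expnS mulnCA natrM -mulrA; apply: (invariant_mulr invA).
by rewrite expnS -mulnA natrM -mulrA; apply: (invariant_mull invA).
Qed.

(** The multiples of one point by the powers of [p] are distinct modulo [1],
    since a coincidence would make that point rational. *)
Lemma invariant_set_close_points {R : realType} {p q : nat} {A : set R} {eps : R} :
  (1 < p)%N -> invariant_set p q A -> without_rationals A -> A !=set0 -> 0 < eps ->
  exists x y, [/\ A x, A y & 0 < y - x < eps].
Proof.
move=> p1 invA irrA [x0 Ax0] eps0.
pose f i : R := p%:R ^+ i * x0 - (Num.floor (p%:R ^+ i * x0))%:~R.
have Af i : A (f i).
  rewrite /f -mulrNz; apply: (invariant_shift invA).
  by have := invariant_mulX i 0 invA Ax0; rewrite muln1 natrX.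
have f_bnd i : 0 <= f i <= 1.
  have := floor_le (p%:R ^+ i * x0); have := floorD1_gt (p%:R ^+ i * x0).
  by rewrite /f intrD; lra.
have lt_neq i j : (i < j)%N -> f i <> f j.
  move=> ij fij.
  have lt : (p ^ i < p ^ j)%N by rewrite ltn_exp2l.
  apply: (irrA x0 (p ^ j - p ^ i)%N
           (Num.floor (p%:R ^+ j * x0) - Num.floor (p%:R ^+ i * x0))) => //.
    by rewrite subn_gt0.
  rewrite natrB ?(ltnW lt) // !natrX intrB mulrBl.
  by move: fij; rewrite /f; lra.
have f_inj : injective f.
  by move=> i j fij; case: (ltngtP i j) => // /lt_neq; rewrite fij.
have [j [i ij]] := bounded_injection_has_close_values f_inj f_bnd eps0.
by exists (f i), (f j).
Qed.

(** If [y - x] is small and positive, its multiples by the products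
    [p ^ c * q ^ d], which are again differences of points of [A], pass [r] with
    small gaps; so [r] is a limit of differences.  It is attained because the
    two points may be translated into a compact set. *)
Lemma invariant_set_differences {R : realType} {p q : nat} {A : set R} {r : R} :
  (1 < p)%N -> (1 < q)%N -> mult_independent p q ->
  invariant_set p q A -> without_rationals A -> A !=set0 -> 0 < r ->
  exists x, A x /\ A (x + r).
Proof.
move=> p1 q1 indep invA irrA A0 r0.
have dense eps : 0 < eps -> exists x y, [/\ A x, A y & `|r - (y - x)| < eps].
  move=> eps0.
  have [N gapN] := products_have_small_gaps (eps / r) p1 q1 indep (divr_gt0 eps0 r0).
  have N1 : 0 < `|N| + 1 by rewrite ltr_wpDl.
  have [x [y [Ax Ay /andP[d0 dlt]]]] :=
    invariant_set_close_points p1 invA irrA A0 (divr_gt0 r0 N1).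
  have /gapN[c [d [le lt]]] : N <= r / (y - x).
    rewrite ler_pdivlMr //; move: dlt; rewrite ltr_pdivlMr // => dlt.
    by have := ler_norm N; nra.
  exists ((p ^ c * q ^ d)%:R * x), ((p ^ c * q ^ d)%:R * y).
  split; try exact: invariant_mulX.
  move: le lt; set s := _%:R; rewrite ler_pdivlMr // ltr_pdivrMr // => le lt.
  rewrite -mulrBr ger0_norm ?subr_ge0 //.
  have : eps / r * (s * (y - x)) <= eps.
    by rewrite mulrAC ler_pdivrMr // ler_pM2l.
  by lra.
pose B := (`[0, 1]%classic `&` A) `*` (`[r - 1, r + 2]%classic `&` A).
have compB : compact B.
  by apply: compact_setX; apply: compact_closedI (invariant_closed invA);
    exact: segment_compact.
pose D := [set xy.2 - xy.1 | xy in B].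
have clD : closed D.
  apply: compact_closed; first exact: Rhausdorff.
  apply: continuous_compact compB; apply: continuous_subspaceT => xy.
  by apply: cvgB; [exact: cvg_snd | exact: cvg_fst].
have [[x y] [[/= _ Ax] [_ Ay]] /= xyr] : D r.
  apply: closed_approx clD _ => eps eps0.
  have [|x [y [Ax Ay]]] := dense (Num.min eps 1); first by rewrite lt_min eps0 ltr01.
  rewrite lt_min => /andP[xy_eps xy1].
  have := floor_le x; have := floorD1_gt x; rewrite intrD => xl xu.
  exists (y - x) => //.
  exists (x - (Num.floor x)%:~R, y - (Num.floor x)%:~R); last by rewrite /=; ring.
  move: xy1; rewrite ltr_norml => /andP[??].
  split; split=> /=; rewrite ?in_itv /=; try lra; rewrite -mulrNz;
    exact: (invariant_shift invA).
by exists x; split=> //; rewrite -xyr addrC subrK.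
Qed.

(** Modulo [1], both multiplications fix [1/t], so the intersection [B] of [A]
    with its translate by [-1/t] is again invariant; it is nonempty because
    [1/t] is a difference of points of [A].  A progression of length [n] in [B]
    is one of length [n.+1] in [A]. *)
Lemma invariant_set_progression {R : realType} {p q t : nat} (n : nat) (A : set R) :
  (1 < p)%N -> (1 < q)%N -> mult_independent p q -> (0 < t)%N ->
  p = 1 %[mod t] -> q = 1 %[mod t] ->
  invariant_set p q A -> without_rationals A -> A !=set0 ->
  exists x, forall i, (i <= n)%N -> A (x + i%:R / t%:R).
Proof.
move=> p1 q1 indep t0 pt qt.
have T0 : 0 < t%:R :> R by rewrite ltr0n.
elim: n A => [|n IHn] A invA irrA A0.
  by case: A0 => x Ax; exists x => [[|//]] _; rewrite mul0r addr0.
have shifted (s : nat) y : (1 < s)%N -> s = 1 %[mod t] ->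
    (forall z, A z -> A (s%:R * z)) -> A (y + t%:R^-1) -> A (s%:R * y + t%:R^-1).
  move=> s1 st stA Ay.
  have /dvdnP[c cE] : (t %| s - 1)%N by rewrite -eqn_mod_dvd ?(ltnW s1) //; apply/eqP.
  have sE : s%:R = 1 + c%:R * t%:R :> R.
    by rewrite -natrM -cE natrB ?(ltnW s1) // addrC subrK.
  have := invariant_shift invA _ (- c%:Z) (stA _ Ay).
  congr (A _); rewrite intrN sE -pmulrn; field; exact: lt0r_neq0.
pose B := A `&` (fun x => x + t%:R^-1) @^-1` A.
have invB : invariant_set p q B.
  split.
  - apply: closedI; first exact: invariant_closed invA.
    apply: preimage_closed; last exact: invariant_closed invA.
    by move=> x _; apply: cvgD; [exact: cvg_id | exact: cvg_cst].
  - move=> x m [Ax Axt]; split; first exact: (invariant_shift invA).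
    by rewrite /preimage /= addrAC; apply: (invariant_shift invA).
  - move=> x [Ax Axt]; split; first exact: (invariant_mull invA).
    by apply: shifted => //; apply: invariant_mull invA.
  - move=> x [Ax Axt]; split; first exact: (invariant_mulr invA).
    by apply: shifted => //; apply: invariant_mulr invA.
have irrB : without_rationals B by move=> x m k [Ax _]; apply: irrA.
have B0 : B !=set0.
  have t0' : 0 < t%:R^-1 :> R by rewrite invr_gt0.
  have [x [Ax Axt]] := invariant_set_differences p1 q1 indep invA irrA A0 t0'.
  by exists x.
have [x Bx] := IHn B invB irrB B0.
exists x => i; rewrite leq_eqVlt ltnS => /orP[/eqP->|/Bx[//]].
have [_] := Bx n (leqnn n).
by rewrite /preimage /= -addrA -natr1 mulrDl mul1r.
Qed.

Lemma mult_independentX {p q k : nat} (l : nat) :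
  (0 < k)%N -> (0 < l)%N -> mult_independent p q -> mult_independent (p ^ k) (q ^ l).
Proof.
move=> k0 l0 indep [a [b [a0 b0 E]]]; apply: indep.
by exists (k * a)%N, (l * b)%N; rewrite !muln_gt0 k0 l0 a0 b0 !expnM E.
Qed.

(** Otherwise [A] contains progressions of step [1/t] around the whole circle,
    for arbitrarily large [t], hence points arbitrarily close to [0]. *)
Lemma invariant_set_rational {R : realType} {p q : nat} {A : set R} :
  (1 < p)%N -> (1 < q)%N -> mult_independent p q ->
  invariant_set p q A -> A !=set0 ->
  exists (n : nat) (x : R) (m : int), [/\ (0 < n)%N, A x & n%:R * x = m%:~R].
Proof.
move=> p1 q1 indep invA A0; apply: contrapT => noQ.
have irrA : without_rationals A by move=> x n m Ax n0 nx; apply: noQ; exists n, x, m.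
suff A00 : A 0 by apply: (irrA 0 1%N 0) => //; rewrite mulr0.
apply: closed_approx (invariant_closed invA) _ => eps eps0.
have p0 : (0 < p)%N := ltnW p1; have q0 : (0 < q)%N := ltnW q1.
(* [t] must be coprime to [p] and [q], and larger than [eps^-1]. *)
pose M := (Num.truncn (eps^-1)).+1; pose t := (p * q * M).+1.
have cop k : (k %| p * q)%N -> coprime k t.
  move=> /dvdnP[c pq]; rewrite /t pq -mulnA mulnCA -addn1 mulnC.
  by rewrite /coprime gcdnMDl gcdn1.
have pt := Euler_exp_totient (cop p (dvdn_mulr _ (dvdnn p))).
have qt := Euler_exp_totient (cop q (dvdn_mull _ (dvdnn q))).
have t_lt : t%:R^-1 < eps.
  rewrite invf_plt ?posrE ?ltr0n //; apply: lt_le_trans (truncnS_gt _) _.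
  by rewrite ler_nat -/M ltnW // ltnS leq_pmull // muln_gt0 p0 q0.
have phi0 : (0 < totient t)%N by rewrite totient_gt0.
have p1' : (1 < p ^ totient t)%N by rewrite -(expn0 p) ltn_exp2l.
have q1' : (1 < q ^ totient t)%N by rewrite -(expn0 q) ltn_exp2l.
have invA' : invariant_set (p ^ totient t) (q ^ totient t) A.
  split; [exact: invariant_closed invA | exact: (invariant_shift invA) | |] => x Ax.
    by have := invariant_mulX (totient t) 0 invA Ax; rewrite muln1.
  by have := invariant_mulX 0 (totient t) invA Ax; rewrite mul1n.
have [x Ax] := invariant_set_progression t A p1' q1'
  (mult_independentX _ phi0 phi0 indep) (ltn0Sn _) pt qt invA' irrA A0.
(* The next integer after [x] lies at distance [y] in ]0, 1], so one of the
   points [x + i / t] with [i <= t] is the last one before it. *)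
pose y := (Num.floor x + 1)%:~R - x.
have y_gt0 : 0 < y by rewrite subr_gt0 floorD1_gt.
have y_le1 : y <= 1 by have := floor_le x; rewrite /y intrD; lra.
have T0 : 0 < t%:R :> R by rewrite ltr0n.
have ty0 : 0 <= t%:R * y by rewrite mulr_ge0 ?ltW.
pose i := Num.truncn (t%:R * y).
have /andP[il iu] := truncn_itv ty0.
have it : (i <= t)%N.
  by rewrite -(ler_nat R); apply: le_trans il _; rewrite ler_piMr // ltW.
exists (x + i%:R / t%:R + (- (Num.floor x + 1))%:~R).
  by apply: (invariant_shift invA); apply: Ax.
rewrite (_ : 0 - _ = y - i%:R / t%:R); last by rewrite /y intrN; ring.
have il' : i%:R / t%:R <= y by rewrite ler_pdivrMr // mulrC.
have iu' : y < i%:R / t%:R + t%:R^-1.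
  by rewrite -[X in _ + X]mul1r -mulrDl natr1 ltr_pdivlMr // mulrC.
by rewrite ger0_norm ?subr_ge0 //; lra.
Qed.

(** * Bringing several coordinates close to integers *)

(** A bound on the distance to the integers given by a witness, so that sums
    and integer multiples are handled without reference to an infimum. *)
Definition near_int {R : realType} (eps x : R) : Prop :=
  exists m : int, `|x - m%:~R| <= eps.

Lemma torus_norm_le {R : realType} {eps x : R} : near_int eps x -> torus_norm x <= eps.
Proof.
move=> [m xm]; apply: le_trans xm; apply: ge_inf; last by exists m.
by exists 0 => _ [k _ <-].
Qed.

Lemma near_int_le {R : realType} {e x : R} (f : R) : e <= f -> near_int e x -> near_int f x.
Proof. by move=> ef [m xm]; exists m; apply: le_trans ef. Qed.

Lemma near_intD {R : realType} {e f x y : R} :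
  near_int e x -> near_int f y -> near_int (e + f) (x + y).
Proof.
move=> [m xm] [k yk]; exists (m + k).
rewrite intrD opprD addrACA; apply: le_trans (ler_normD _ _) _; exact: lerD.
Qed.

Lemma near_intM {R : realType} {e x : R} (c : nat) :
  near_int e x -> near_int (c%:R * e) (c%:R * x).
Proof.
move=> [m xm]; exists (c%:Z * m); rewrite intrM -pmulrn -mulrBr normrM normr_nat.
exact: ler_wpM2l.
Qed.

Lemma near_int_sum {R : realType} {I : Type} (r : seq I) (e x : I -> R) :
  (forall i, near_int (e i) (x i)) -> near_int (\sum_(i <- r) e i) (\sum_(i <- r) x i).
Proof.
move=> ex; elim: r => [|i r IHr]; last by rewrite !big_cons; apply: near_intD.
by rewrite !big_nil; exists 0; rewrite subrr normr0.
Qed.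

Lemma closure_stable {T : topologicalType} {f : T -> T} {A : set T} :
  continuous f -> (forall x, A x -> A (f x)) -> forall x, closure A x -> closure A (f x).
Proof. by move=> cf fA x Ax B /cf/Ax[y [Ay By]]; exists (f y); split=> //; apply: fA. Qed.

(** The closure of the orbit of [x] contains a rational point, and [n] is its
    denominator. *)
Lemma orbit_near_int {R : realType} {p q : nat} (x : R) :
  (1 < p)%N -> (1 < q)%N -> mult_independent p q ->
  exists2 n : nat, (0 < n)%N & forall eps : R, 0 < eps ->
    exists a b : nat, near_int eps (n%:R * ((p ^ a * q ^ b)%:R * x)).
Proof.
move=> p1 q1 indep.
pose O := [set y : R | exists (a b : nat) (m : int), y = (p ^ a * q ^ b)%:R * x + m%:~R].
have O0 : closure O !=set0.
  exists (1 * x + 0); apply: subset_closure; exists 0%N, 0%N, 0.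
  by rewrite !expn0 muln1.
have invO : invariant_set p q (closure O).
  split; first exact: closed_closure.
  - move=> y m Oy; apply: (@closure_stable _ (fun z : R => z + m%:~R)) Oy.
      by move=> z; apply: cvgD; [exact: cvg_id | exact: cvg_cst].
    by move=> z [a [b [k ->]]]; exists a, b, (k + m); rewrite intrD addrA.
  - apply: closure_stable; first exact: mulrl_continuous.
    move=> z [a [b [k ->]]]; exists a.+1, b, (p%:Z * k).
    by rewrite expnS -mulnA natrM intrM -pmulrn; ring.
  - apply: closure_stable; first exact: mulrl_continuous.
    move=> z [a [b [k ->]]]; exists a, b.+1, (q%:Z * k).
    by rewrite expnS mulnCA natrM intrM -pmulrn; ring.
have [n [y [m [n0 Oy ny]]]] := invariant_set_rational p1 q1 indep invO O0.
exists n => // eps eps0.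
have N0 : 0 < n%:R :> R by rewrite ltr0n.
have [_ [[a [b [k ->]]] yz]] := Oy _ (nbhsx_ballx y _ (divr_gt0 eps0 N0)).
exists a, b, (m - n%:Z * k).
rewrite intrB intrM -pmulrn -ny -normrN.
rewrite (_ : - _ = n%:R * (y - ((p ^ a * q ^ b)%:R * x + k%:~R))); last by ring.
rewrite normrM normr_nat mulrC -ler_pdivlMr //; exact: ltW yz.
Qed.

Lemma unit_interval_sequence_cluster {R : realType} (u : nat -> R) :
  (forall i, 0 <= u i <= 1) ->
  exists y, forall (delta : R) (M : nat), 0 < delta ->
    exists2 m, (M <= m)%N & `|u m - y| <= delta.
Proof.
move=> u01.
have [|y [_ clu]] := @segment_compact R 0 1 (u @ \oo) _.
  by exists 0%N => // i _ /=; rewrite in_itv /= u01.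
exists y => delta M delta0.
have tail : (u @ \oo) [set u i | i in [set i | (M <= i)%N]].
  by exists M => // i Mi; exists i.
have [_ [[m Mm <-] um]] := clu _ _ tail (nbhsx_ballx y _ delta0).
by exists m => //; rewrite distrC; apply: ltW um.
Qed.

(** An entry [(e, x)] of [l] is a coordinate [x] on which [s] acts as
    multiplication by [s ^ e].  In the induction step, the last coordinate
    converges to some [y] along a sequence [s] adapted to the other ones, and a
    product [t] of powers of [p] and [q] adapted to [y] is fixed before the
    index [m] in this sequence; [t * s m] is then suitable for all the
    coordinates. *)
Lemma simultaneous_near_int {R : realType} {S : set nat} {p q : nat} {l : seq (nat * R)} :
  (forall a b, S a -> S b -> S (a * b)%N) -> S p -> S q ->
  (1 < p)%N -> (1 < q)%N -> mult_independent p q ->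
  (forall y, y \in l -> (0 < y.1)%N) ->
  exists2 n : nat, (0 < n)%N & forall eps : R, 0 < eps ->
    exists2 s, S s & forall y, y \in l -> near_int eps (n%:R * (s%:R ^+ y.1 * y.2)).
Proof.
move=> SM Sp Sq p1 q1 indep.
have p0 : (0 < p)%N := ltnW p1; have q0 : (0 < q)%N := ltnW q1.
have SX a b s : S s -> S (p ^ a * q ^ b * s)%N.
  move=> Ss; elim: a => [|a IHa]; last by rewrite expnS -!mulnA; apply: SM; rewrite ?mulnA.
  elim: b => [|b IHb]; first by rewrite !mul1n.
  by rewrite mul1n expnS -mulnA; apply: SM => //; move: IHb; rewrite mul1n.
elim: l => [|[e0 x0] l IHl] l_pos; first by exists 1%N => // eps _; exists p.
have e0_gt0 : (0 < e0)%N by apply: (l_pos (e0, x0)); rewrite mem_head.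
have [|n n0 near_l] := IHl; first by move=> y ly; apply: l_pos; rewrite in_cons ly orbT.
have /choice[s sP] (m : nat) : exists s, S s /\
    forall y, y \in l -> near_int (m.+1%:R^-1 : R) (n%:R * (s%:R ^+ y.1 * y.2)).
  by have [|s Ss sl] := near_l (m.+1%:R^-1); [rewrite invr_gt0 | exists s].
pose v m : R := (s m)%:R ^+ e0 * x0.
pose u m : R := v m - (Num.floor (v m))%:~R.
have u01 m : 0 <= u m <= 1.
  by have := floor_le (v m); have := floorD1_gt (v m); rewrite /u intrD; lra.
have [y cluster_y] := unit_interval_sequence_cluster _ u01.
have pe1 : (1 < p ^ e0)%N by rewrite -(expn0 p) ltn_exp2l.
have qe1 : (1 < q ^ e0)%N by rewrite -(expn0 q) ltn_exp2l.
have [n' n'0 near_y] := orbit_near_int y pe1 qe1 (mult_independentX _ e0_gt0 e0_gt0 indep).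
exists (n * n')%N; first by rewrite muln_gt0 n0.
move=> eps eps0.
have N0 : 0 < n%:R :> R by rewrite ltr0n.
have e2 : 0 < eps / 2 / n%:R by rewrite !divr_gt0.
have [a [b]] := near_y _ e2.
set t := (p ^ a * q ^ b)%N.
have -> : (((p ^ e0) ^ a * (q ^ e0) ^ b)%N)%:R = t%:R ^+ e0 :> R.
  by rewrite -natrX expnMn -!expnM !(mulnC e0).
move=> near_ty.
have t0 : (0 < t)%N by rewrite muln_gt0 !expn_gt0 p0 q0.
have St k : S k -> S (t * k)%N by apply: SX.
clearbody t.
(* [C] bounds the factor by which multiplying by [t] and clearing denominators
   can enlarge any of the errors. *)
pose E := (e0 + \sum_(y <- l) y.1)%N.
have leE z : z \in l -> (z.1 <= E)%N.
  by move=> zl; rewrite /E (big_rem z) //= addnCA leq_addr.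
pose C := (n * n' * t ^ E)%N.
have C0 : 0 < C%:R :> R by rewrite ltr0n !muln_gt0 n0 n'0 expn_gt0 t0.
have d0 : 0 < eps / 2 / C%:R by rewrite !divr_gt0.
have [m] := cluster_y _ (Num.truncn (C%:R / eps)) d0.
rewrite -ltnS => Mm um.
have Cm : C%:R * m.+1%:R^-1 <= eps.
  rewrite ler_pdivrMr // mulrC -ler_pdivrMr //.
  apply: le_trans (ltW (truncnS_gt _)) _; by rewrite ler_nat.
have [Ssm sml] := sP m.
exists (t * s m)%N; first exact: St.
move=> z; rewrite in_cons => /predU1P[->/=|zl].
- have -> : (n * n')%:R * ((t * s m)%:R ^+ e0 * x0) =
      (n * n' * t ^ e0)%:R * (v m - y) + n%:R * (n'%:R * (t%:R ^+ e0 * y)).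
    by rewrite /v !natrM exprMn natrX; ring.
  rewrite [eps]splitr; apply: near_intD; last first.
    by apply: near_int_le (near_intM n near_ty); rewrite mulrC divfK // lt0r_neq0.
  have near_v : near_int (eps / 2 / C%:R) (v m - y).
    by exists (Num.floor (v m)); rewrite addrAC.
  apply: near_int_le (near_intM _ near_v).
  rewrite mulrCA ger_pMr ?divr_gt0 // ler_pdivrMr // mul1r ler_nat.
  by rewrite leq_mul2l leq_pexp2l ?leq_addr ?orbT.
- have -> : (n * n')%:R * ((t * s m)%:R ^+ z.1 * z.2) =
      (n' * t ^ z.1)%:R * (n%:R * ((s m)%:R ^+ z.1 * z.2)).
    by rewrite !natrM exprMn natrX; ring.
  apply: near_int_le (near_intM _ (sml z zl)); apply: le_trans Cm.
  rewrite ler_pM2r ?invr_gt0 // ler_nat /C -mulnA -[X in (X <= _)%N]mul1n.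
  by rewrite leq_mul // leq_mul2l leq_pexp2l ?leE ?orbT.
Qed.

(** * Recurrence of polynomial values *)
Lemma int_poly_nonzero_eventually {P : {poly int}} : P != 0 ->
  exists B : nat, forall z : nat, (B < z)%N -> P.[z%:Z] != 0.
Proof.
move=> Pn0; pose Q := map_poly (intr : int -> rat) P.
have Qn0 : Q != 0.
  by rewrite -size_poly_gt0 size_map_inj_poly ?size_poly_gt0 //; exact: intr_inj.
have [b Qb] := Cauchy_root_bound Qn0.
exists (Num.truncn b) => z bz; apply/eqP => Pz.
have : root Q (z%:Z)%:~R by rewrite /root horner_map Pz rmorph0.
move=> /Qb; rewrite -pmulrn normr_nat leNgt => /negP; apply.
apply: lt_le_trans (truncnS_gt b) _; by rewrite ler_nat.
Qed.

Theorem theorem2 (R : realType) (Sigma K : set nat) (P : {poly int})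
  (Sigma_semigroup : is_semigroup Sigma)
  (Sigma_non_lacunary : non_lacunary Sigma)
  (K_pos : K `<=` posnats)
  (K_multiples : forall n : nat, (0 < n)%N -> exists k : nat, K k /\ (n %| k)%N)
  (P_nonconstant : (1 < size P)%N)
  (P0 : P.[0] = 0) :
  bohr_recurrence R [set P.[(k * s)%N%:Z] | k in K & s in Sigma].
Proof.
move=> d alpha eps _ eps0.
have [Sigma_pos SigmaM] := Sigma_semigroup.
have [p [q [Sp Sq p1 q1 indep]]] := Sigma_non_lacunary.
pose D := size P.
pose x i j : R := (P`_i)%:~R * alpha j.
pose l := [seq (i, x i j) | i <- iota 1 D.-1, j <- enum 'I_d].
have l_pos y : y \in l -> (0 < y.1)%N.
  by case/allpairsP => -[i j] [/=]; rewrite mem_iota => /andP[i1 _] _ ->.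
have [n n0 near_l] := simultaneous_near_int SigmaM Sp Sq p1 q1 indep l_pos.
have Pn0 : P != 0 by rewrite -size_poly_gt0 ltnW.
have [B PB] := int_poly_nonzero_eventually Pn0.
(* The factor [n] makes [k] clear the denominators; the factor [B.+1] makes
   [k * s] exceed the roots of [P]. *)
have nB0 : (0 < n * B.+1)%N by rewrite muln_gt0 n0.
have [k [Kk /dvdnP[c kE]]] := K_multiples _ nB0.
have k0 : (0 < k)%N by apply: K_pos.
have D0 : (0 < D)%N by exact: ltnW P_nonconstant.
have kD0 : (0 < D * k ^ D)%N by rewrite muln_gt0 D0 expn_gt0 k0.
have kDR : 0 < (D * k ^ D)%:R :> R by rewrite ltr0n.
(* [P] has at most [D] terms, each an integer multiple, by a factor at most
   [k ^ D], of a quantity controlled by the choice of [s]. *)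
have [s Ss near_s] := near_l (eps / (D * k ^ D)%:R) (divr_gt0 eps0 kDR).
have s0 : (0 < s)%N by apply: Sigma_pos.
exists P.[(k * s)%N%:Z]; split; first by exists k => //; exists s.
- apply: PB; apply: leq_trans (leq_pmulr k s0).
  rewrite kE mulnA leq_pmull // muln_gt0 n0 andbT.
  by move: k0; rewrite kE; case: (c).
move=> j; apply: torus_norm_le.
have -> : (P.[(k * s)%N%:Z])%:~R * alpha j = \sum_(i < D) (k * s)%:R ^+ i * x i j.
  rewrite horner_coef rmorph_sum mulr_suml; apply: eq_bigr => i _.
  by rewrite rmorphM rmorphXn /= -pmulrn mulrAC /x [RHS]mulrC.
have -> : eps = \sum_(i < D) (eps / D%:R).
  by rewrite sumr_const card_ord -[RHS]mulr_natr divfK // pnatr_eq0 -lt0n.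
apply: near_int_sum => -[[|i] iD] /=.
  (* The constant term vanishes, since [P.[0] = 0]. *)
  exists 0; rewrite expr0 mul1r /x -horner_coef0 P0 mul0r subrr normr0.
  by rewrite divr_ge0 // ltW.
have xl : (i.+1, x i.+1 j) \in l.
  apply/allpairsP; exists (i.+1, j); split=> //=; last by rewrite mem_enum.
  by rewrite mem_iota /= add1n prednK.
have nk : k = (n * (c * B.+1))%N by rewrite kE; ring.
have -> : (k * s)%:R ^+ i.+1 * x i.+1 j =
    (k ^ i * (c * B.+1))%:R * (n%:R * (s%:R ^+ i.+1 * x i.+1 j)).
  rewrite [in LHS]natrM exprMn [k%:R ^+ _]exprSr {2}nk !natrM natrX; ring.
apply: near_int_le (near_intM _ (near_s _ xl)).
have ki0 : (k ^ i * (c * B.+1) <= k ^ D)%N.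
  apply: (@leq_trans (k ^ i.+1)); last by rewrite leq_pexp2l // ltnW.
  by rewrite expnSr leq_mul2l {2}nk leq_pmull ?orbT.
have X0 : 0 < (k ^ D)%:R :> R by rewrite ltr0n expn_gt0 k0.
have D0R : 0 < D%:R :> R by rewrite ltr0n.
rewrite (natrM _ D) invfM [eps * _]mulrA mulrCA ger_pMr ?divr_gt0 // ler_pdivrMr //.
by rewrite mul1r ler_nat.
Qed.
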